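(* For $n\geq 1$, we have $$|s^{-1}(\mathrm{Av}_n(231,312,321))|=\sum_{k=0}^{n-1}\frac{1}{n+1}\binom{n-k-1}{k}\binom{2n-2k}{n}.$$
   Context: $S_n$ is the set of permutations of $\{1,\ldots,n\}$, written as words. The stack-sorting map $s$ is defined recursively on words of distinct positive integers: $s$ sends the empty word to itself, and if $\pi=LNR$ where $N$ is the largest entry of $\pi$, then $s(\pi)=s(L)s(R)N$. Thus $s$ maps $S_n$ to $S_n$, and $s^{-1}(A)=\{\sigma\in S_n: s(\sigma)\in A\}$ for $A\subseteq S_n$. $\mathrm{Av}_n(\tau^{(1)},\ldots,\tau^{(r)})$ is the set of permutations in $S_n$ avoiding (in the classical sense) all the patterns $\tau^{(1)},\ldots,\tau^{(r)}$. Binomial coefficients $\binom ab$ are $0$ unless $0\le b\le a$. *)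

(* Defs.v *)
From mathcomp Require Import all_boot.
From mathcomp Require Import finmap.

Set Implicit Arguments.
Unset Strict Implicit.
Unset Printing Implicit Defensive.

Definition Sn (n : nat) : {fset seq nat} :=
  [fset w in permutations (iota 1 n)]%fset.

(* The recursion s(LNR) = s(L) s(R) N is not structural, so it runs on a fuel
   argument; the size of the word is always enough (see [stack_sort_cat]). *)
Fixpoint stack_sort_rec (fuel : nat) (w : seq nat) : seq nat :=
  if fuel is fuel'.+1 then
    if w is [::] then [::] else
    let N := \max_(x <- w) x in
    let L := take (index N w) w in
    let R := drop (index N w).+1 w in
    stack_sort_rec fuel' L ++ stack_sort_rec fuel' R ++ [:: N]
  else [::].

Definition stack_sort (w : seq nat) : seq nat := stack_sort_rec (size w) w.

Lemma stack_sort_rec_enough (f g : nat) (w : seq nat) :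
  size w <= f -> size w <= g -> stack_sort_rec f w = stack_sort_rec g w.
Proof.
elim: f g w => [|f IH] [|g] [|x w] //= hf hg.
set N := \max_(y <- _) y; set i := index N (x :: w).
have hmem : N \in x :: w.
  rewrite /N; elim: w x {IH hf hg N i} => [|y w IHw] x.
    by rewrite big_cons big_nil maxn0 inE.
  rewrite big_cons; case: leqP => _; first by rewrite inE IHw orbT.
  by rewrite inE eqxx.
have hi : i < (size w).+1 by rewrite -[X in _ < X]/(size (x :: w)) index_mem.
have hL : size (take i (x :: w)) <= size w.
  by rewrite size_takel //=; exact: ltnW.
have hR : size (drop i w) <= size w by rewrite size_drop leq_subr.
congr (_ ++ (_ ++ _)); apply: IH.
- exact: leq_trans hL hf.
- exact: leq_trans hL hg.
- exact: leq_trans hR hf.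
- exact: leq_trans hR hg.
Qed.

Lemma stack_sort_nil : stack_sort [::] = [::].
Proof. by []. Qed.

Lemma stack_sort_cat (L R : seq nat) (N : nat) :
    all (fun x => x < N) L -> all (fun x => x < N) R ->
  stack_sort (L ++ N :: R) = stack_sort L ++ stack_sort R ++ [:: N].
Proof.
move=> hL hR.
have hmax : \max_(x <- L ++ N :: R) x = N.
  apply/eqP; rewrite eqn_leq; apply/andP; split.
    apply/bigmax_leqP_seq => x; rewrite mem_cat inE.
    case/or3P=> [xL|/eqP->|xR] _ //; apply: ltnW.
      exact: (allP hL).
    exact: (allP hR).
  by apply: (@leq_bigmax_seq _ _ _ id); rewrite // mem_cat inE eqxx orbT.
have NL : N \notin L by apply/negP => /(allP hL); rewrite ltnn.
have hidx : index N (L ++ N :: R) = size L.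
  by rewrite index_cat (negbTE NL) /= eqxx addn0.
rewrite /stack_sort size_cat /= addnS.
have -> : stack_sort_rec (size L + size R).+1 (L ++ N :: R) =
    let M := \max_(x <- L ++ N :: R) x in
    stack_sort_rec (size L + size R) (take (index M (L ++ N :: R)) (L ++ N :: R))
    ++ stack_sort_rec (size L + size R)
         (drop (index M (L ++ N :: R)).+1 (L ++ N :: R)) ++ [:: M].
  by case: (L) => [|? ?].
rewrite /= hmax hidx take_size_cat // drop_cat ltnNge leqnSn /= subSnn /= drop0.
by congr (_ ++ (_ ++ _)); apply: stack_sort_rec_enough;
  rewrite ?leq_addr ?leq_addl.
Qed.

(* [contains w t]: some strictly increasing choice [f] of positions in [w]
   picks out a subword in the same relative order as [t]. *)
Definition contains (w t : seq nat) : bool :=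
  [exists f : {ffun 'I_(size t) -> 'I_(size w)},
    [forall a : 'I_(size t), forall b : 'I_(size t),
      ((a < b) ==> (f a < f b)) &&
      ((nth 0 t a < nth 0 t b) == (nth 0 w (f a) < nth 0 w (f b)))]].

Definition Av (n : nat) (ts : seq (seq nat)) : {fset seq nat} :=
  [fset w in Sn n | all (fun t => ~~ contains w t) ts]%fset.

Definition stack_sort_preim (n : nat) (A : {fset seq nat}) : {fset seq nat} :=
  [fset w in Sn n | stack_sort w \in A]%fset.

(* Main.v *)
(* A permutation sigma is the inorder reading of a decreasing binary plane tree T, and
   s(sigma) is its postorder reading. A permutation avoids 231, 312 and 321 iff its
   entries at distance at least two are in increasing order, that is, iff it is the
   identity with disjoint adjacent pairs swapped. A tree shape can be labelled by such
   a permutation in postorder iff no swapped pair (i, i+1) has i+1 as the parent of i,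
   i.e. iff node i+1 is a leaf. So one counts binary trees with a set of marked leaves,
   none first and no two consecutive in postorder. Recording the number of trees of the
   postorder forest turns them into lattice paths with two kinds of level steps and
   marked up-steps, which the cycle lemma counts; here the resulting closed form is
   checked against the recurrence for the number of completions of a path. *)

Require Import Defs.
From mathcomp Require Import all_boot all_order all_algebra.
From mathcomp Require Import finmap.
From mathcomp Require Import ring lra zify.
Import GRing.Theory Num.Theory.
Set Implicit Arguments.
Unset Strict Implicit.

(** * Permutations avoiding 231, 312 and 321 *)

Definition spread_sorted (w : seq nat) : Prop :=
  forall i j, i.+1 < j -> j < size w -> nth 0 w i < nth 0 w j.

Lemma spread_sorted_rcons2 (u : seq nat) (a b : nat) :
  spread_sorted (rcons (rcons u a) b) <->
  spread_sorted (rcons u a) /\ all (fun x => x < b) u.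
Proof.
split=> [h | [h /allP hb] i j ij].
  split=> [i j ij | ].
    rewrite size_rcons => jlt; have ilt : i < (size u).+1 by lia.
    have := h i j ij.
    by rewrite !(nth_rcons _ (rcons u a)) !size_rcons jlt ilt; apply; lia.
  apply/(all_nthP 0) => i ilt.
  have ilt' : i < (size u).+1 by lia.
  have := h i (size u).+1.
  by rewrite !nth_rcons !size_rcons ltnn eqxx ilt ilt'; apply; lia.
rewrite !size_rcons ltnS leq_eqVlt => /orP [/eqP ej | jlt].
  have iu : i < size u by lia.
  have ilt : i < (size u).+1 by lia.
  rewrite !(nth_rcons _ (rcons u a)) !size_rcons ej ltnn eqxx ilt nth_rcons iu.
  by apply: hb; rewrite mem_nth.
have ilt : i < (size u).+1 by lia.
rewrite !(nth_rcons _ (rcons u a)) !size_rcons jlt ilt.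
by apply: h; rewrite ?size_rcons.
Qed.

Lemma containsP3 (w : seq nat) (a b c : nat) :
  reflect (exists i j l, [/\ [&& i < j, j < l & l < size w],
      [/\ (a < b) = (nth 0 w i < nth 0 w j),
          (a < c) = (nth 0 w i < nth 0 w l) &
          (b < c) = (nth 0 w j < nth 0 w l)] &
      [/\ (b < a) = (nth 0 w j < nth 0 w i),
          (c < a) = (nth 0 w l < nth 0 w i) &
          (c < b) = (nth 0 w l < nth 0 w j)]])
    (contains w [:: a; b; c]).
Proof.
apply: (iffP existsP) => [[f /forallP h] | [i [j [l]]]]; last first.
  move=> [/and3P [ij jl ll] [h1 h2 h3] [h4 h5 h6]].
  have il : i < size w by lia.
  have jl' : j < size w by lia.
  exists [ffun x : 'I_3 => nth (Ordinal ll) [:: Ordinal il; Ordinal jl'; Ordinal ll] x].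
  apply/forallP => [[[|[|[|x]]] hx]] //; apply/forallP => [[[|[|[|y]]] hy]] //;
    rewrite !ffunE /= ?ltnn ?h1 ?h2 ?h3 ?h4 ?h5 ?h6 ?eqxx ?andbT //; lia.
have {}h x y := andP (forallP (h x) y).
pose o0 : 'I_3 := @Ordinal 3 0 isT; pose o1 : 'I_3 := @Ordinal 3 1 isT.
pose o2 : 'I_3 := @Ordinal 3 2 isT.
exists (f o0), (f o1), (f o2).
move: (h o0 o1) (h o1 o2) (h o0 o2) (h o1 o0) (h o2 o1) (h o2 o0).
move=> /= [h1 /eqP h2] [h3 /eqP h4] [_ /eqP h5] [_ /eqP h6] [_ /eqP h7] [_ /eqP h8].
by split; [rewrite h1 h3 ltn_ord | split | split].
Qed.

(** If the entries at [i] and [j > i + 1] are out of order, the entry at [i + 1] completes one of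
    the patterns, its value deciding which. Conversely, each pattern ends below its first value. *)
Lemma avoids_spread_sorted (w : seq nat) : uniq w ->
  all (fun t => ~~ contains w t) [:: [:: 2; 3; 1]; [:: 3; 1; 2]; [:: 3; 2; 1]]
  <-> spread_sorted w.
Proof.
move=> uw; split=> [/= /and4P [n1 n2 n3 _] i j ij jw | h].
  rewrite ltnNge; apply/negP => le.
  have neq x y : x < size w -> y < size w -> x != y -> nth 0 w x != nth 0 w y.
    by move=> xw yw; rewrite nth_uniq.
  have d1 : nth 0 w i != nth 0 w j by apply: neq; lia.
  have d2 : nth 0 w i != nth 0 w i.+1 by apply: neq; lia.
  have d3 : nth 0 w i.+1 != nth 0 w j by apply: neq; lia.
  have pos : [&& i < i.+1, i.+1 < j & j < size w] by lia.
  case: (ltnP (nth 0 w i) (nth 0 w i.+1)) => c1.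
    case/negP: n1; apply/containsP3; exists i, i.+1, j; split=> //; split; lia.
  case: (ltnP (nth 0 w j) (nth 0 w i.+1)) => c2.
    case/negP: n3; apply/containsP3; exists i, i.+1, j; split=> //; split; lia.
  case/negP: n2; apply/containsP3; exists i, i.+1, j; split=> //; split; lia.
rewrite /= andbT; apply/and3P; split;
  apply/containsP3 => -[i [j [l [/and3P [ij jl lw] [_ e _] _]]]];
  by move: e; rewrite h //; lia.
Qed.

(** * Preimages under stack-sorting *)

Lemma split_at_max (w : seq nat) : uniq w -> w != [::] ->
  exists L R N, [/\ w = L ++ N :: R, all (fun x => x < N) L & all (fun x => x < N) R].
Proof.
move=> uw w0.
have [N Nw maxN] : exists2 N, N \in w & forall x, x \in w -> x <= N.
  elim: w w0 {uw} => // x [|y w] IH _.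
    by exists x; rewrite ?mem_head // => z; rewrite inE => /eqP ->.
  have [//|N Nw maxN] := IH.
  exists (maxn x N) => [|z].
    by rewrite inE; case: (leqP x N) => _; rewrite ?Nw ?orbT ?eqxx.
  by rewrite inE => /orP [/eqP ->|/maxN]; rewrite leq_max ?leqnn // orbC => ->.
case/splitPr: Nw uw maxN => L R; rewrite cat_uniq /= negb_or.
move=> /and3P [_ /andP [NL _] /andP [NR _]] maxN; exists L, R, N.
split=> //; apply/allP => x xI; rewrite ltn_neqAle maxN ?mem_cat ?inE ?xI ?orbT //
  andbT.
  by apply: contraNneq NL => <-.
by apply: contraNneq NR => <-.
Qed.

Lemma perm_stack_sort (w : seq nat) : uniq w -> perm_eq (stack_sort w) w.
Proof.
elim: {w}(size w) {-2}w (leqnn (size w)) => [|n IH] w.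
  by rewrite leqn0 size_eq0 => /eqP ->.
have [-> //|w0] := eqVneq w [::].
move=> + uw; have [L [R [N [ew hL hR]]]] := split_at_max uw w0; subst w.
rewrite size_cat /= addnS ltnS => sz; rewrite stack_sort_cat //.
move: uw; rewrite cat_uniq /= => /and3P [uL _ /andP [_ uR]].
rewrite perm_sym cats1 -rcons_cat perm_sym perm_rcons.
rewrite perm_sym perm_catC /= perm_cons perm_catC perm_sym.
by apply: perm_cat; apply: IH => //; lia.
Qed.

(* A stack lists nonempty words from last to first; its output is the
   concatenation, in reading order, of the images of its words under s. *)
Fixpoint sorted_output (st : seq (seq nat)) : seq nat :=
  if st is w :: st' then sorted_output st' ++ stack_sort w else [::].

(* All ways to append N to the output, for N above every letter of the stack.
   In terms of decreasing binary trees read in postorder: a new leaf, a node with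
   a left child only, one with a right child only, and one with two children. *)
Definition push (N : nat) (st : seq (seq nat)) : seq (seq (seq nat)) :=
  ([:: N] :: st) ::
  if st is w :: st' then
    [:: rcons w N :: st', (N :: w) :: st' &
      if st' is w' :: st'' then [:: (w' ++ N :: w) :: st''] else [::]]
  else [::].

(** An empty subtree is not a tree of the forest, so an empty word must not enter the stack. *)
Definition cons_nonempty (w : seq nat) (st : seq (seq nat)) :=
  if w is [::] then st else w :: st.

Lemma flatten_cons_nonempty (w : seq nat) (st : seq (seq nat)) :
  flatten (cons_nonempty w st) = w ++ flatten st.
Proof. by case: w. Qed.

Lemma sorted_output_cons_nonempty (w : seq nat) (st : seq (seq nat)) :
  sorted_output (cons_nonempty w st) = sorted_output st ++ stack_sort w.
Proof. by case: w; rewrite //= cats0. Qed.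

Lemma mem_nil_cons_nonempty (w : seq nat) (st : seq (seq nat)) :
  ([::] \in cons_nonempty w st) = ([::] \in st).
Proof. by case: w. Qed.

(** Undoes [push N]: deleting the root [N] of the last tree leaves its nonempty subtrees as the last
    trees, the right one on top. *)
Definition pop (N : nat) (st : seq (seq nat)) : seq (seq nat) :=
  if st is w :: st' then
    cons_nonempty (drop (index N w).+1 w) (cons_nonempty (take (index N w) w) st')
  else [::].

Lemma pop_cat (N : nat) (L R : seq nat) (st : seq (seq nat)) : N \notin L ->
  pop N ((L ++ N :: R) :: st) = cons_nonempty R (cons_nonempty L st).
Proof.
move=> NL; rewrite /pop index_cat (negbTE NL) /= eqxx addn0 take_size_cat //.
by rewrite drop_cat ltnNge leqnSn /= subSnn /= drop0.
Qed.

(** The four kinds of push are one construction, distinguished by which of [L] and [R] are empty. *)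
Lemma pushP (N : nat) (st st' : seq (seq nat)) : [::] \notin st ->
  (st' \in push N st) <->
  exists L R st0, st = cons_nonempty R (cons_nonempty L st0) /\
    st' = (L ++ N :: R) :: st0.
Proof.
move=> n0; split=> [|[L [R [st0 [-> ->]]]]].
  case: st n0 => [|w [|w' st0]]; rewrite /push !inE ?negb_or.
  - by move=> _ /eqP ->; exists [::], [::], [::].
  - move=> /= w0 /or3P [] /eqP ->.
    + by exists [::], [::], [:: w].
    + by exists w, [::], [::]; rewrite cats1; case: w w0.
    + by exists [::], w, [::]; case: w w0.
  - move=> /and3P [w0 w'0 _] /or4P [] /eqP ->.
    + by exists [::], [::], [:: w, w' & st0].
    + by exists w, [::], (w' :: st0); rewrite cats1; case: w w0.
    + by exists [::], w, (w' :: st0); case: w w0.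
    + by exists w', w, st0; case: w w0; case: w' w'0.
case: L n0 => [|x L]; case: R => [|y R] _; rewrite /push !inE ?eqxx ?orbT //=.
  by rewrite cats1 /= eqxx orbT.
Qed.

Lemma pushK (N : nat) (st st' : seq (seq nat)) : [::] \notin st ->
  N \notin flatten st -> st' \in push N st -> pop N st' = st.
Proof.
move=> n0 NN /(pushP N st' n0) [L [R [st0 [est ->]]]]; move: NN.
rewrite est !flatten_cons_nonempty !mem_cat !negb_or => /and3P [_ NL _].
by rewrite pop_cat.
Qed.

Lemma push_uniq (N : nat) (st : seq (seq nat)) : [::] \notin st ->
  N \notin flatten st -> uniq (push N st).
Proof.
move=> n0 NN.
have neq w w' s s' : w != w' :> seq nat -> (w :: s == w' :: s') = false.
  by rewrite eqseq_cons => /negbTE ->.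
have rconsN x w : N \notin x :: w -> rcons (x :: w) N != N :: x :: w.
  by rewrite inE rcons_cons eqseq_cons eq_sym => /norP [/negbTE ->].
have hsz (w w' : seq nat) : size w != size w' -> w != w'.
  by apply: contraNneq => ->.
case: st n0 NN => [|[|x w] [|[|y w'] st]] //= _ NN; rewrite !inE /= !neq //.
(* Lengths of top words separate all results except [rcons w N] from [N :: w], which differ in their
   first letter. *)
all: try by apply: hsz; rewrite /= ?size_cat ?size_rcons /=; lia.
  by apply: rconsN; rewrite cats0 in NN.
by apply: rconsN; move: NN; rewrite -cat_cons mem_cat => /norP [].
Qed.

Lemma mem_push_pop (N : nat) (w : seq nat) (st : seq (seq nat)) :
  [::] \notin st -> N \in w -> w :: st \in push N (pop N (w :: st)).
Proof.
move=> n0 Nw; rewrite -{1}(cat_take_drop (index N w) w) (drop_nth 0) ?index_mem //.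
rewrite nth_index // /pop; apply/pushP; last first.
  by exists (take (index N w) w), (drop (index N w).+1 w), st.
by rewrite !mem_nil_cons_nonempty.
Qed.

Lemma pop_nonempty (N : nat) (st : seq (seq nat)) :
  [::] \notin st -> [::] \notin pop N st.
Proof.
case: st => // w st; rewrite inE => /norP [_ n0]; rewrite /pop.
by rewrite !mem_nil_cons_nonempty.
Qed.

Lemma push_nonempty (N : nat) (st st' : seq (seq nat)) :
  [::] \notin st -> st' \in push N st -> [::] \notin st'.
Proof.
move=> n0 /(pushP N st' n0) [L [R [st0 [est ->]]]].
move: n0; rewrite est !mem_nil_cons_nonempty inE negb_or => ->.
by case: (L).
Qed.

Lemma perm_push (N : nat) (st st' : seq (seq nat)) :
  [::] \notin st -> st' \in push N st -> perm_eq (flatten st') (N :: flatten st).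
Proof.
move=> n0 /(pushP N st' n0) [L [R [st0 [-> ->]]]] /=.
rewrite !flatten_cons_nonempty.
by rewrite -catA -cat_cons perm_catCA.
Qed.

(** Postorder visits a root right after its two subtrees, here the last trees of the forest. *)
Lemma sorted_output_push (N : nat) (st st' : seq (seq nat)) :
  [::] \notin st -> all (fun x => x < N) (flatten st) -> st' \in push N st ->
  sorted_output st' = rcons (sorted_output st) N.
Proof.
move=> n0 ltN /(pushP N st' n0) [L [R [st0 [est ->]]]] /=; move: ltN.
rewrite est !flatten_cons_nonempty.
rewrite !all_cat => /and3P [hR hL _]; rewrite stack_sort_cat //.
by rewrite !sorted_output_cons_nonempty -cats1 !catA.
Qed.

Lemma perm_sorted_output (st : seq (seq nat)) :
  uniq (flatten st) -> perm_eq (sorted_output st) (flatten st).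
Proof.
elim: st => //= w st IH; rewrite cat_uniq => /and3P [uw _ ust].
by rewrite perm_catC; apply: perm_cat; [apply: perm_stack_sort | apply: IH].
Qed.

(** * Generating the stacks with admissible output *)

Lemma perm_iotaS (n : nat) (s : seq nat) :
  perm_eq (n.+1 :: s) (iota 1 n.+1) = perm_eq s (iota 1 n).
Proof.
by rewrite -(addn1 n) iotaD add1n addn1 cats1 perm_sym perm_rcons perm_sym perm_cons.
Qed.

Lemma perm_iotaSS (n : nat) (s t : seq nat) : perm_eq t (n.+2 :: s) ->
  perm_eq (n.+1 :: t) (iota 1 n.+2) = perm_eq s (iota 1 n).
Proof.
move=> pt; have /permPl -> : perm_eq (n.+1 :: t) ([:: n.+2] ++ [:: n.+1] ++ s).
  by rewrite perm_sym (perm_catCA [:: n.+2] [:: n.+1]) perm_cons perm_sym.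
by rewrite /= !perm_iotaS.
Qed.

Lemma all_iota_lt (n : nat) (s : seq nat) :
  perm_eq s (iota 1 n) -> all (fun x => x < n.+1) s.
Proof. by move/perm_all=> ->; apply/allP => x; rewrite mem_iota; lia. Qed.

Lemma spread_sorted_rcons_max (u : seq nat) (N : nat) :
  spread_sorted u -> all (fun x => x < N) u -> spread_sorted (rcons u N).
Proof.
case/lastP: u => [_ _ [|i] [|j] //|u a h].
by rewrite all_rcons => /andP [_ ltN]; apply/spread_sorted_rcons2.
Qed.

Lemma spread_sorted_prefix (u : seq nat) (N : nat) :
  spread_sorted (rcons u N) -> spread_sorted u.
Proof. by case/lastP: u => [_ i j //|u a /spread_sorted_rcons2 []]. Qed.

(* All stacks on {1, ..., n} whose output avoids 231, 312 and 321: such an output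
   ends in n, or in n, n - 1, and in the latter case the word ending the output in
   n - 1 cannot contain n, so it is the single letter n - 1. *)
Fixpoint stacks (n : nat) : seq (seq (seq nat)) :=
  if n is n1.+1 then
    [seq st' | st <- stacks n1, st' <- push n st] ++
    (if n1 is n2.+1 then
       [seq [:: n1] :: st' | st <- stacks n2, st' <- push n st]
     else [::])
  else [:: [::]].

Lemma stacksS (n : nat) : stacks n.+1 =
  [seq st' | st <- stacks n, st' <- push n.+1 st] ++
  (if n is n'.+1 then [seq [:: n] :: st' | st <- stacks n', st' <- push n.+1 st]
   else [::]).
Proof. by case: n. Qed.

Definition valid_stack (n : nat) (st : seq (seq nat)) : Prop :=
  [/\ [::] \notin st, perm_eq (flatten st) (iota 1 n) &
      spread_sorted (sorted_output st)].

Lemma stack_sort1 (x : nat) : stack_sort [:: x] = [:: x].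
Proof. by rewrite (@stack_sort_cat [::] [::] x). Qed.

Lemma output_lt (n : nat) (st : seq (seq nat)) :
  perm_eq (flatten st) (iota 1 n) -> all (fun x => x < n.+1) (sorted_output st).
Proof.
move=> pst; apply: all_iota_lt; apply: perm_trans (pst); apply: perm_sorted_output.
by rewrite (perm_uniq pst) iota_uniq.
Qed.

Lemma mem_stacks_valid (n : nat) (st : seq (seq nat)) :
  st \in stacks n -> valid_stack n st.
Proof.
elim/ltn_ind: n st => -[|n] IH st.
  by rewrite inE => /eqP ->; split=> // i j.
rewrite stacksS mem_cat => /orP [/allpairsPdep [st0 [st' [/IH]]]|].
  move=> /(_ (ltnSn n)) [n0 p0 s0] st'push ->.
  have lt0 := all_iota_lt p0; split; first exact: push_nonempty st'push.
    by rewrite (permPl (perm_push n0 st'push)) perm_iotaS.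
  rewrite (sorted_output_push n0 lt0 st'push).
  by apply: spread_sorted_rcons_max => //; apply: output_lt.
case: n IH => // n IH /allpairsPdep [st0 [st' [/IH]]].
move=> /(_ (ltnW (ltnSn _))) [n0 p0 s0] st'push ->.
have lt0 : all (fun x => x < n.+2) (flatten st0).
  by apply: sub_all (all_iota_lt p0) => x; lia.
have ltout := output_lt p0; split.
- by rewrite inE negb_or (push_nonempty n0 st'push).
- by rewrite /= (perm_iotaSS (perm_push n0 st'push)).
rewrite /= (sorted_output_push n0 lt0 st'push) stack_sort1 cats1.
apply/spread_sorted_rcons2; split=> //; apply: spread_sorted_rcons_max => //.
by apply: sub_all ltout => x; lia.
Qed.

(** The top word ends the output with its own maximum, so a final [N] lies in that word and [pop N]
    yields [st0]. *)
Lemma output_rcons_push (u : seq nat) (N : nat) (st : seq (seq nat)) :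
  [::] \notin st -> uniq (flatten st) -> all (fun x => x <= N) (flatten st) ->
  sorted_output st = rcons u N ->
  exists st0, [/\ [::] \notin st0, st \in push N st0,
    perm_eq (flatten st) (N :: flatten st0),
    all (fun x => x < N) (flatten st0) & sorted_output st0 = u].
Proof.
case: st => [|w st] n0; first by case: u.
move=> ust leN eout; have w0 : w != [::].
  by apply: contraNneq n0 => ->; rewrite inE eqxx.
have uw : uniq w by move: ust; rewrite /= cat_uniq => /and3P [].
have [L [R [M [ew hL hR]]]] := split_at_max uw w0.
have eM : M = N.
  move: eout; rewrite /= ew stack_sort_cat // catA cats1 -rcons_cat.
  by case/rcons_inj.
have Nw : N \in w by rewrite ew eM mem_cat inE eqxx orbT.
exists (pop N (w :: st)).
have n0' := pop_nonempty N n0.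
have wpush : w :: st \in push N (pop N (w :: st)).
  by apply: mem_push_pop => //; apply: contra n0; rewrite inE orbC => ->.
have pp := perm_push n0' wpush.
have lt0 : all (fun x => x < N) (flatten (pop N (w :: st))).
  move: leN ust; rewrite (perm_all _ pp) (perm_uniq pp) /= => /andP [_ /allP leN].
  move=> /andP [NN _]; apply/allP => x xp; rewrite ltn_neqAle leN // andbT.
  by apply: contraNneq NN => {1}<-.
split=> //; have := sorted_output_push n0' lt0 wpush.
by rewrite eout => /rcons_inj [].
Qed.

Lemma valid_mem_stacks (n : nat) (st : seq (seq nat)) :
  valid_stack n st -> st \in stacks n.
Proof.
elim/ltn_ind: n st => -[|n] IH st [n0 pst sst].
  case: st n0 pst {sst} => //= w st; rewrite inE negb_or => /andP [w0 _].
  by move/perm_size; case: w w0.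
have ust : uniq (flatten st) by rewrite (perm_uniq pst) iota_uniq.
have pout := perm_trans (perm_sorted_output ust) pst.
have lest : all (fun x => x <= n.+1) (flatten st) := all_iota_lt pst.
case/lastP eout: (sorted_output st) pout sst => [|u N] pout sst.
  by have := perm_size pout.
have [eN|NneS] := eqVneq N n.+1.
  rewrite eN in eout.
  have [st0 [n0' stp pp lt0 out0]] := output_rcons_push n0 ust lest eout.
  rewrite stacksS mem_cat; apply/orP; left; apply/allpairsPdep.
  exists st0, st; split=> //; apply: IH => //; split=> //.
    by rewrite -perm_iotaS -(permPl pp).
  by rewrite out0; apply: spread_sorted_prefix sst.
have Sout : n.+1 \in rcons u N by rewrite (perm_mem pout) mem_iota; lia.
have /andP [N0 Nout] : (0 < N) && (N < n.+1).
  have : N \in iota 1 n.+1 by rewrite -(perm_mem pout) mem_rcons inE eqxx.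
  by rewrite mem_iota; lia.
case/lastP: u => [|u a] in eout pout sst Sout *.
  by move: Sout; rewrite inE eq_sym (negbTE NneS).
have /spread_sorted_rcons2 [sua ltu] := sst.
(* Letters of [u] are below [N], so the maximum, not being last, is next to last. *)
have ea : a = n.+1.
  move: Sout; rewrite !(mem_rcons, inE) eq_sym (negbTE NneS) /=.
  by move=> /orP [/eqP -> //|/(allP ltu)]; lia.
have eN : N = n.
  have : n \in rcons (rcons u a) N.
    rewrite (perm_mem pout) mem_iota.
    have : N \in iota 1 n.+1 by rewrite -(perm_mem pout) mem_rcons inE eqxx.
    by rewrite mem_iota; lia.
  rewrite !(mem_rcons, inE) => /or3P [/eqP -> //|/eqP|/(allP ltu)]; lia.
case: st => [|w st] // in n0 pst sst ust lest eout pout *.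
have w0 : w != [::] by apply: contraNneq n0 => ->; rewrite inE eqxx.
have uw : uniq w by move: ust; rewrite /= cat_uniq => /and3P [].
have ust' : uniq (flatten st) by move: ust; rewrite /= cat_uniq => /and3P [].
have n0st : [::] \notin st by apply: contra n0; rewrite inE orbC => ->.
have [L [R [M [ew hL hR]]]] := split_at_max uw w0.
have [eu eM] : sorted_output st ++ stack_sort L ++ stack_sort R = rcons u a /\ M = N.
  move: eout; rewrite /= ew stack_sort_cat // 2!catA cats1 => /rcons_inj [].
  by rewrite catA.
have pLR : perm_eq (stack_sort L ++ stack_sort R) (L ++ R).
  move: uw; rewrite ew cat_uniq /= => /and3P [uL _ /andP [_ uR]].
  by apply: perm_cat; apply: perm_stack_sort.
(* A last letter of s(L) s(R) would be [a = N + 1], yet [L] and [R] hold only letters below [N]. *)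
have LR0 : L ++ R = [::].
  apply/nilP; rewrite /nilp -(perm_size pLR).
  case/lastP eLR: (stack_sort L ++ stack_sort R) => [//|v b].
  have eb : b = a by move: eu; rewrite eLR -rcons_cat => /rcons_inj [].
  have : a \in L ++ R by rewrite -(perm_mem pLR) eLR eb mem_rcons inE eqxx.
  by rewrite mem_cat => /orP [/(allP hL)|/(allP hR)]; rewrite eM eN ea ltnNge leqnSn.
have {LR0} [L0 R0] : L = [::] /\ R = [::] by case: (L) LR0.
rewrite L0 R0 cats0 in eu; rewrite L0 R0 eM /= in ew.
rewrite stacksS mem_cat; apply/orP; right.
case: n => [|n] in IH pst lest pout NneS Nout Sout ea eN *; first by rewrite eN in N0.
apply/allpairsPdep.
have lest' : all (fun x => x <= a) (flatten st).
  by rewrite ea; move: lest; rewrite all_cat => /andP [].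
have [st0 [n0' stp pp lt0 out0]] := output_rcons_push n0st ust' lest' eu.
rewrite ea in stp pp sua.
exists st0, st; split=> //; last by rewrite ew eN.
apply: IH => //; split=> //; last by rewrite out0; apply: spread_sorted_prefix sua.
by rewrite -(perm_iotaSS pp); move: pst; rewrite /= ew eN.
Qed.

Lemma stacks_uniq (n : nat) : uniq (stacks n).
Proof.
elim/ltn_ind: n => -[//|n] IH; rewrite stacksS cat_uniq.
have notin k m st : st \in stacks k -> k < m -> m \notin flatten st.
  move=> /mem_stacks_valid [_ p _] km; rewrite (perm_mem p) mem_iota; lia.
have nonempty k st : st \in stacks k -> [::] \notin st.
  by move=> /mem_stacks_valid [].
apply/and3P; split.
- apply: allpairs_uniq_dep; first exact: IH.
    by move=> st sti; apply: push_uniq; [exact: nonempty sti | exact: notin sti _].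
  move=> _ v /allpairsPdep [s1 [t1 [s1i t1i ->]]].
  move=> /allpairsPdep [s2 [t2 [s2i t2i ->]]] /= e.
  move: t1i t2i; rewrite -e => /pushK t1i /pushK t2i.
  by rewrite -[s1]t1i ?(nonempty _ _ s1i) ?(notin _ _ _ s1i) // t2i
  ?(nonempty _ _ s2i) ?(notin _ _ _ s2i).
(* The two families are disjoint: the top word contains the largest letter in the first, and is the
   single letter one below it in the second. *)
- case: n IH => // n IH; apply/hasPn => _ /allpairsPdep [s1 [t1 [s1i t1i ->]]].
  apply/negP => /allpairsPdep [s2 [t2 [s2i /(pushP _ _ (nonempty _ _ s2i))]]].
  move=> [L [R [st0 [_ ->]]]] [e _].
  have : n.+2 \in [:: n.+1] by rewrite e mem_cat inE eqxx orbT.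
  by rewrite inE; lia.
case: n IH => // n IH; apply: allpairs_uniq_dep; first by apply: IH; lia.
  by move=> st sti; apply: push_uniq; [exact: nonempty sti | apply: notin sti _; lia].
move=> _ v /allpairsPdep [s1 [t1 [s1i t1i ->]]].
move=> /allpairsPdep [s2 [t2 [s2i t2i ->]]] /= [e].
move: t1i t2i; rewrite -e => /pushK t1i /pushK t2i.
have lt : n < n.+2 by lia.
by rewrite -[s1]t1i ?(nonempty _ _ s1i) ?(notin _ _ _ s1i) // t2i
  ?(nonempty _ _ s2i) ?(notin _ _ _ s2i).
Qed.

(** * Counting marked paths *)

Local Open Scope ring_scope.

(* The number of paths of m = N + k steps from height a that first reach 0 at the end,
   with steps U = +1, D = -1, two kinds of level steps, and k marked up-steps V, no two
   of them adjacent. By the cycle lemma it is a / m times the number of words with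
   total -a in these letters, with k letters V, no two of them cyclically adjacent. *)
Definition ballot_term (N k a : nat) : rat :=
  a%:R / N%:R * 'C(N, k)%:R * 'C(2 * N, N + k + a)%:R.

(** Expresses neighbouring binomials through a common factor, which turns the recurrences into
    identities of rational functions. *)
Lemma binS_natr (n m : nat) :
  'C(n, m.+1)%:R = (n%:R - m%:R) / m.+1%:R * 'C(n, m)%:R :> rat.
Proof.
have m0 : m.+1%:R != 0 :> rat by rewrite pnatr_eq0.
case: (leqP m n) => [le|lt]; last by rewrite !bin_small ?mulr0 // ltnW.
apply: (mulfI m0); rewrite -natrM mul_bin_left natrM natrB //.
by rewrite !mulrA (mulrC m.+1%:R) mulfK.
Qed.

Lemma binSS_natr (n m : nat) :
  'C(n.+2, m.+2)%:R = 'C(n, m)%:R + 2 * 'C(n, m.+1)%:R + 'C(n, m.+2)%:R :> rat.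
Proof. by rewrite !binS -natrM -!natrD; congr (_%:R); lia. Qed.

Lemma ballot_term_rec0 (M a : nat) : (0 < M)%N ->
  ballot_term M.+1 0 a.+1 =
  ballot_term M 0 a + 2 * ballot_term M 0 a.+1 + ballot_term M 0 a.+2.
Proof.
move=> M0; rewrite /ballot_term !bin0 !addn0.
have -> : (M.+1 + a.+1 = (M + a).+2)%N by lia.
have -> : (2 * M.+1 = (2 * M).+2)%N by lia.
rewrite binSS_natr !addnS (binS_natr _ (M + a).+1) (binS_natr _ (M + a)).
rewrite (natrM _ 2 M) -!natr1 !natrD.
have a0 : 0 <= a%:R :> rat by rewrite ler0n.
have Mpos : 1 <= M%:R :> rat by rewrite ler1n.
move: a0 Mpos ('C(_, _)%:R).
move: (M%:R) (a%:R) => x y hy hx c.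
field; apply/and4P; split; apply: lt0r_neq0; lra.
Qed.

(** The first group takes an unmarked first step; the second takes V together with the next step,
    which is not V. *)
Lemma ballot_term_recS (M k a : nat) : (0 < M)%N ->
  ballot_term M.+1 k.+1 a.+1 =
    (ballot_term M k.+1 a + 2 * ballot_term M k.+1 a.+1 + ballot_term M k.+1 a.+2)
  + (ballot_term M k a.+1 + 2 * ballot_term M k a.+2 + ballot_term M k a.+3).
Proof.
move=> M0; rewrite /ballot_term.
have -> : (M.+1 + k.+1 + a.+1 = (M + k + a).+3)%N by lia.
have -> : (2 * M.+1 = (2 * M).+2)%N by lia.
have -> : (M + k.+1 + a = (M + k + a).+1)%N by lia.
have -> : (M + k.+1 + a.+1 = (M + k + a).+2)%N by lia.
have -> : (M + k.+1 + a.+2 = (M + k + a).+3)%N by lia.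
rewrite binSS_natr binS !addnS (natrD _ 'C(_, _)) (binS_natr (2 * M) (M + k + a).+2).
rewrite (binS_natr (2 * M) (M + k + a).+1) (binS_natr M) (natrM _ 2 M) -!natr1 !natrD.
move: 'C(M, k) 'C(_, (M + k + a).+1%N) => p c.
have a0 : 0 <= a%:R :> rat by rewrite ler0n.
have k0 : 0 <= k%:R :> rat by rewrite ler0n.
have Mpos : 1 <= M%:R :> rat by rewrite ler1n.
move: a0 k0 Mpos; move: (M%:R) (k%:R) (a%:R) => x z y hy hz hx.
field; do ?[apply/andP; split]; apply: lt0r_neq0; lra.
Qed.

Definition ballot_sum (m a : nat) : rat := \sum_(k < m) ballot_term (m - k) k a.

(* [step f a] is the sum of [f] over the sizes of the stacks that [push] makes from
   a stack of size [a]. *)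
Definition step (f : nat -> rat) (a : nat) : rat :=
  f a.+1 + (if a is b.+1 then 2 * f a + (if b is _.+1 then f b else 0) else 0).

Definition stack_sum (n : nat) (f : nat -> rat) : rat :=
  \sum_(st <- stacks n) f (size st).

Lemma ballot_sum0r (m : nat) : ballot_sum m 0 = 0.
Proof. by apply: big1 => k _; rewrite /ballot_term !mul0r. Qed.

(** A one-word stack allows no merge, which matches the value 0 at height 0. *)
Lemma step_ballot_sum (m a : nat) : step (ballot_sum m) a.+1 =
  ballot_sum m a + 2 * ballot_sum m a.+1 + ballot_sum m a.+2.
Proof. by case: a => [|a]; rewrite /step ?ballot_sum0r; ring. Qed.

Lemma ballot_sum_rec (m a : nat) : ballot_sum m.+2 a.+1 =
  step (ballot_sum m.+1) a.+1 + step (ballot_sum m) a.+2.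
Proof.
have sums n b : step (ballot_sum n) b.+1 = \sum_(k < n)
    (ballot_term (n - k) k b + 2 * ballot_term (n - k) k b.+1 +
     ballot_term (n - k) k b.+2).
  by rewrite step_ballot_sum !big_split /= -mulr_sumr.
(* The top index [k = m + 1] leaves [N = 1], and its binomial of upper entry 2 vanishes. *)
rewrite !sums {1}/ballot_sum big_ord_recr /= [X in _ + X](_ : _ = 0); last first.
  by rewrite /ballot_term (@bin_small (2 * _)) ?mulr0 //; lia.
rewrite addr0 !big_ord_recl /= !subn0 ballot_term_rec0 // -[RHS]addrA; congr (_ + _).
rewrite -big_split; apply: eq_bigr => k _ /=; rewrite /bump /= add1n.
have -> : (m.+2 - k.+1 = (m - k).+1)%N by have := ltn_ord k; lia.
by rewrite subSS ballot_term_recS // subn_gt0.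
Qed.

(** * Stack sums as path counts *)

Lemma sum_push (N : nat) (st : seq (seq nat)) (f : nat -> rat) :
  \sum_(st' <- push N st) f (size st') = step f (size st).
Proof.
case: st => [|w [|w' st]]; rewrite /push !big_cons big_nil /step /=; ring.
Qed.

Lemma stack_sum0 (f : nat -> rat) : stack_sum 0 f = f 0.
Proof. by rewrite /stack_sum big_cons big_nil addr0. Qed.

Lemma stack_sum1 (f : nat -> rat) : stack_sum 1 f = f 1.
Proof. by rewrite /stack_sum big_cons big_nil addr0. Qed.

Lemma stack_sum_rec (n : nat) (f : nat -> rat) : stack_sum n.+2 f =
  stack_sum n.+1 (step f) + stack_sum n (step (fun a => f a.+1)).
Proof.
rewrite /stack_sum stacksS big_cat !big_allpairs_dep; congr (_ + _).
  by apply: eq_bigr => st _; rewrite -(sum_push n.+2).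
by apply: eq_bigr => st _; rewrite -(sum_push n.+2).
Qed.

Lemma step_add (f g : nat -> rat) (a : nat) :
  step (fun b => f b + g b) a = step f a + step g a.
Proof. by rewrite /step; case: a => [|[|a]]; ring. Qed.

(** [step] evaluates its argument at positive sizes only, where the ballot recurrence is
    available. *)
Lemma eq_step (f g : nat -> rat) (a : nat) :
  (forall b, (0 < b)%N -> f b = g b) -> step f a = step g a.
Proof. by move=> e; rewrite /step; case: a => [|[|a]]; rewrite !e. Qed.

(* Cut a path of j + m + 2 steps after step j + 1: the first term counts the prefixes
   not ending in V, the second those ending in V, whose next step is not V. *)
Lemma stack_ballot_invariant (j m : nat) :
  stack_sum j.+1 (step (ballot_sum m.+1)) +
  stack_sum j (step (fun a => step (ballot_sum m) a.+1)) = ballot_sum (j + m).+2 1.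
Proof.
elim: j m => [|j IH] m.
  rewrite stack_sum0 stack_sum1 ballot_sum_rec; congr (_ + _).
  by rewrite /step addr0.
rewrite stack_sum_rec addSnnS -IH addrAC; congr (_ + _).
rewrite -big_split; apply: eq_bigr => st _ /=; rewrite -step_add.
by apply: eq_step => -[|b] // _; rewrite ballot_sum_rec.
Qed.

Lemma stack_sum_single (n : nat) :
  stack_sum n.+1 (fun a => (a == 1)%:R) = ballot_sum n.+1 1.
Proof.
(* A single step first reaches 0 only from height 1, so the indicator of one-word stacks is
   [ballot_sum 1] at positive sizes. *)
have P1 a : ballot_sum 1 a.+1 = (a.+1 == 1)%:R.
  rewrite /ballot_sum big_ord1 /ballot_term subn0 bin0 mulr1 divr1.
  by case: a => [|a]; rewrite ?(@binn 2) ?mulr1 // bin_small ?mulr0.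
case: n => [|n]; first by rewrite stack_sum1 P1.
rewrite stack_sum_rec -[n in RHS]addn0 -stack_ballot_invariant; congr (_ + _).
  by apply: eq_bigr => st _; apply: eq_step => -[|b] // _; rewrite P1.
(* Both sides vanish: a nonempty stack with one more word has several words, and [ballot_sum 0] is
   an empty sum. *)
apply: eq_bigr => st _; apply: eq_step => -[|b] // _; rewrite /step /ballot_sum !big_ord0.
by case: b => [|b]; rewrite !(mulr0, addr0).
Qed.

(** * The closed form and the final count *)

(** Termwise with N = n - k: C(2N, n + 1) = (N - k) / (n + 1) C(2N, n), and (N - k) / N C(N, k) =
    C(N - 1, k). *)
Lemma ballot_sum1 (n : nat) : ballot_sum n 1 =
  \sum_(k < n) 1 / (n%:R + 1) * 'C(n - k - 1, k)%:R * 'C(2 * n - 2 * k, n)%:R.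
Proof.
apply: eq_bigr => -[k /= kn] _; rewrite /ballot_term -mulnBr.
have [M eM] : exists M, (n - k = M.+1)%N by exists (n - k).-1; lia.
rewrite eM subn1 /= [in RHS](_ : n = M.+1 + k)%N; last by lia.
rewrite addn1 (binS_natr _ (M.+1 + k)) (natrM _ 2) -!natr1 !(natrD _ _ k).
move: 'C(_, (M.+1 + k)%N) => c.
have M0 : 0 <= M%:R :> rat by rewrite ler0n.
case: k {kn} eM => [|k] _.
  rewrite !bin0; field.
  by apply/andP; split; apply: lt0r_neq0; lra.
rewrite binS natrD binS_natr -!natr1.
have k0 : 0 <= k%:R :> rat by rewrite ler0n.
move: 'C(_, _) => p; field.
by do ?[apply/andP; split]; apply: lt0r_neq0; lra.
Qed.

(** A permutation [w] corresponds to the one-word stack [[:: w]], whose output is s(w). *)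
Lemma card_preim_stacks (n : nat) :
  #|` stack_sort_preim n.+1
       (Av n.+1 [:: [:: 2; 3; 1]; [:: 3; 1; 2]; [:: 3; 2; 1]]%N)| =
  count (fun st => size st == 1)%N (stacks n.+1).
Proof.
set A := stack_sort_preim _ _.
have memA w : (w \in A) = ([:: w] \in stacks n.+1).
  apply/idP/idP.
    rewrite !inE => /andP [pw /andP [_ av]].
    rewrite mem_permutations in pw.
    have uw : uniq w by rewrite (perm_uniq pw) iota_uniq.
    apply: valid_mem_stacks; split; rewrite /= ?cats0 //.
      by rewrite inE; apply: contraTneq pw => <-; apply/negP => /perm_size.
    apply/avoids_spread_sorted => //.
    by rewrite (perm_uniq (perm_stack_sort uw)).
  move=> /mem_stacks_valid [_]; rewrite [flatten _]cats0 => pw sw.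
  have uw : uniq w by rewrite (perm_uniq pw) iota_uniq.
  have ps := perm_stack_sort uw.
  rewrite !inE !mem_permutations pw (perm_trans ps pw) /=.
  by apply/avoids_spread_sorted; rewrite ?(perm_uniq ps).
rewrite -size_filter -(size_map (head [::])); apply: perm_size.
apply: uniq_perm; first exact: fset_uniq.
  rewrite map_inj_in_uniq ?filter_uniq ?stacks_uniq //.
  move=> [|w [|? ?]] [|w' [|? ?]]; rewrite !mem_filter //= => _ _ -> //.
move=> w; rewrite -[LHS]/(w \in A) memA; apply/idP/mapP => [wi|[st]].
  by exists [:: w]; rewrite ?mem_filter.
by rewrite mem_filter => /andP []; case: st => [|w' [|? ?]] //= _ sti ->.
Qed.

Unset Implicit Arguments.

Theorem theorem6p2 (n : nat) (hn : (1 <= n)%N) :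
  #|` stack_sort_preim n (Av n [:: [:: 2; 3; 1]; [:: 3; 1; 2]; [:: 3; 2; 1]]%N) |%:R
  = \sum_(0 <= k < n)
      1 / (n%:R + 1) * 'C(n - k - 1, k)%:R * 'C(2 * n - 2 * k, n)%:R :> rat.
Proof.
case: n hn => // n _; rewrite big_mkord -ballot_sum1 -stack_sum_single.
rewrite card_preim_stacks -sum1_count natr_sum big_mkcond.
by apply: eq_bigr => st _; case: (size st == 1)%N.
Qed.
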